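(* Let $\alpha$ be a composition. Then $$\mathcal S_\alpha=\sum_\beta d_{\alpha\beta}F_\beta,$$ summed over compositions $\beta$, where $d_{\alpha\beta}$ is the number of standard augmented fillings (SAFs) $T$ of shape $\gamma$, for some weak composition $\gamma$ with positive last part and $\alpha(\gamma)=\alpha$, such that $\beta(\mathcal D(T))=\beta$; equivalently, $d_{\alpha\beta}$ is the number of standard ComTs $T$ of shape $\alpha$ with $\beta(\mathcal D(T))=\beta$.
   Context: A weak composition is a finite sequence $\gamma=(\gamma_1,\dots,\gamma_n)$ of nonnegative integers; a composition has all parts positive; $|\gamma|=\sum\gamma_i$; $\alpha(\gamma)$ is obtained from $\gamma$ by deleting zero parts. For $S=\{i_1<\dots<i_{k-1}\}\subseteq\{1,\dots,N-1\}$, $\beta(S)=(i_1,i_2-i_1,\dots,N-i_{k-1})$. For a composition $\alpha=(\alpha_1,\dots,\alpha_k)$, $M_\alpha=\sum_{i_1<\dots<i_k}x_{i_1}^{\alpha_1}\cdots x_{i_k}^{\alpha_k}$ and $F_\alpha=\sum_\beta M_\beta$ over compositions $\beta$ such that $\alpha$ is obtained from $\beta$ by adding adjacent parts. SSAFs. The augmented diagram of $\gamma=(\gamma_1,\dots,\gamma_n)$ has cells $(i,j)$, $1\le i\le n$ (row, from top), $0\le j\le\gamma_i$ (column); column $0$ is the basement, cell $(i,0)$ containing $i$. An augmented filling assigns positive integers to non-basement cells. Cells $(i,j),(i',j')$ attack if $j=j'$, or $j=j'+1$ and $i>i'$; non-attacking means distinct attacking cells (basement included) have distinct entries. When comparing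 entries in a triple, of two equal entries the one appearing first when read top to bottom, right to left counts as smaller. Type A triple: $c=(i,k-1)$, $a=(i,k)$, $b=(j,k)$, $i<j$, $k\ge1$, $\gamma_i\ge\gamma_j$; inversion triple if in increasing order $a<c<b$, $c<b<a$ or $b<a<c$. Type B triple: $a=(i,k)$, $b=(j,k)$, $c=(j,k+1)$, $i<j$, $k\ge0$, $\gamma_j>\gamma_i$; inversion triple if in increasing order $a<c<b$, $c<b<a$ or $b<a<c$. An SSAF of shape $\gamma$ is a non-attacking augmented filling with rows (basement included) weakly decreasing left to right and all type A and B triples inversion triples; $x^F=\prod_i x_i^{w_i(F)}$ with $w_i(F)$ the number of non-basement cells containing $i$. An SAF of shape $\gamma$ is an SSAF with $x^F=x_1x_2\cdots x_{|\gamma|}$; its descent set $\mathcal D(F)$ is the set of $i\in\{1,\dots,|\gamma|-1\}$ such that the non-basement cell containing $i+1$ is not in a column strictly left of the non-basement cell containing $i$. $\mathcal A_\gamma=\sum_F x^F$ over SSAFs of shape $\gamma$; $\mathcal S_\alpha=\sum_\gamma \mathcal A_\gamma$ over weak compositions $\gamma$ with positive last part and $\alpha(\gamma)=\alpha$. ComTs. For a composition $\alpha=(\alpha_1,\dots,\alpha_\ell)$ with largest part $m$, a ComT of shape $\alpha$ is a filling of the left-justified diagram with $\alpha_i$ cells in row $i$ by positive integers with rows weakly decreasing left to right, leftmost column strictly increasing top to bottom, and such that, padding rows with $0$'s to an $\ell\times m$ array $\hat T$, for $1\le i<j\le\ell$, $2\le k\le m$: $\hat T(j,k)\ne0$ and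 $\hat T(j,k)\ge\hat T(i,k)$ imply $\hat T(j,k)>\hat T(i,k-1)$. It is standard if its $N$ cells contain $1,\dots,N$ once each; then $\mathcal D(T)$ is the set of $i\in\{1,\dots,N-1\}$ such that $i+1$ does not appear in a column strictly left of the column of $i$. *)

(* Defs.v *)
From mathcomp Require Import all_boot all_order all_algebra.
From mathcomp Require Import finmap multiset.
From mathcomp Require Import boolp classical_sets functions cardinality fsbigop.

Set Implicit Arguments.
Unset Strict Implicit.
Unset Printing Implicit Defensive.

Import GRing.Theory.

Local Open Scope classical_set_scope.
Local Open Scope ring_scope.
Local Open Scope nat_scope.

(** * Formal power series in x_1, x_2, ... *)

(** A monomial is the multiset of its variable indices (the multiplicity of [i]
    is the exponent of [x_i]); a series is its coefficient function. The index
    [0] is available in the type, but no series below involves [x_0]. *)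
Notation monomial := ({mset nat}%mset).

Definition fps := monomial -> int.

Definition mono (u : monomial) : fps := fun m => (m == u)%:R%R.

(** Infinite sums are taken coefficientwise. [\sum_(i \in A)] is [0] when the
    support is infinite; the [summable_*] lemmas at the end of this file show
    that every family summed below is summable. *)
Definition summable (I : choiceType) (A : set I) (f : I -> fps) : Prop :=
  forall m, finite_set [set i | A i /\ f i m <> 0%R].

Definition psum (I : choiceType) (A : set I) (f : I -> fps) : fps :=
  fun m => (\sum_(i \in A) f i m)%R.

(** * Compositions *)

(** Weak compositions are arbitrary elements of [seq nat]; the weight is [sumn]. *)
Definition is_composition (a : seq nat) : bool := all (leq 1) a.

Definition compress (g : seq nat) : seq nat := [seq x <- g | 0 < x].

(** For [g = [::]] the condition on the last part is vacuous, so that the empty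
    composition has exactly one expansion, [[::]]. *)
Definition expansion (a g : seq nat) : Prop := 0 < last 1 g /\ compress g = a.

(** beta(S) for the subset S of {1, ..., N-1} listed increasingly by [s]. *)
Definition beta (N : nat) (s : seq nat) : seq nat :=
  if N == 0 then [::] else pairmap (fun x y => y - x) 0 (rcons s N).

(** [a] is obtained from [b] by adding adjacent parts: [bs] cuts [b] into
    nonempty consecutive blocks whose sums are the parts of [a]. *)
Definition coarsening (a b : seq nat) : Prop :=
  exists bs : seq (seq nat),
    [/\ [::] \notin bs, flatten bs = b & map sumn bs = a].

(** * Monomial and fundamental quasisymmetric functions *)

Definition M_index (a : seq nat) : set (seq nat) :=
  [set i | [/\ size i = size a, all (leq 1) i & sorted ltn i]].

Definition M_term (a i : seq nat) : monomial :=
  \big[msetD/mset0]_(p <- zip i a) msetn p.2 p.1.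

Definition qsym_M (a : seq nat) : fps :=
  psum (M_index a) (fun i => mono (M_term a i)).

Definition F_index (a : seq nat) : set (seq nat) :=
  [set b | is_composition b /\ coarsening a b].

Definition qsym_F (a : seq nat) : fps := psum (F_index a) qsym_M.

(** * Fillings *)

(** A filling is the list of its rows from top to bottom, each row being the
    list of its (non-basement) entries from left to right; its shape is
    [seq.shape]. Rows and columns are numbered from 1 and column 0 is the
    basement. *)
Definition filling := seq (seq nat).

Definition part (g : seq nat) (i : nat) : nat := nth 0 g i.-1.

(** 1-based access, padding with 0. *)
Definition entry (T : filling) (i k : nat) : nat := nth 0 (nth [::] T i.-1) k.-1.

Definition content (T : filling) : monomial := seq_mset (flatten T).

Definition positive_entries (T : filling) : bool := all (all (leq 1)) T.

(** Column of the first cell containing [v] (the only one if [T] is standard). *)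
Definition column (T : filling) (v : nat) : nat :=
  (index v (nth [::] T (find (fun r => v \in r) T))).+1.

(** The set {1, ..., N-1} cut down to the descents, listed increasingly. *)
Definition descents (T : filling) : seq nat :=
  [seq i <- iota 1 (size (flatten T)).-1 | ~~ (column T i.+1 < column T i)].

Definition descent_composition (T : filling) : seq nat :=
  beta (size (flatten T)) (descents T).

(** * Semi-standard augmented fillings *)

Definition cell := (nat * nat)%type.

Definition in_aug_diagram (g : seq nat) (c : cell) : bool :=
  (0 < c.1 <= size g) && (c.2 <= part g c.1).

Definition aug_entry (T : filling) (c : cell) : nat :=
  if c.2 == 0 then c.1 else entry T c.1 c.2.

Definition attack (c d : cell) : bool :=
  (c.2 == d.2) || ((c.2 == d.2.+1) && (d.1 < c.1)).

Definition non_attacking (g : seq nat) (T : filling) : Prop :=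
  forall c d : cell, in_aug_diagram g c -> in_aug_diagram g d ->
    c != d -> attack c d -> aug_entry T c != aug_entry T d.

(** Columns from right to left, each column from top to bottom. *)
Definition read_before (c d : cell) : bool :=
  (d.2 < c.2) || ((c.2 == d.2) && (c.1 < d.1)).

Definition cell_lt (T : filling) (c d : cell) : bool :=
  (aug_entry T c < aug_entry T d)
  || ((aug_entry T c == aug_entry T d) && read_before c d).

Definition inversion_triple (T : filling) (a b c : cell) : bool :=
  [|| cell_lt T a c && cell_lt T c b,
      cell_lt T c b && cell_lt T b a
    | cell_lt T b a && cell_lt T a c].

Definition type_A_ok (g : seq nat) (T : filling) : Prop :=
  forall i j k : nat, 0 < i -> i < j -> 0 < k -> part g j <= part g i ->
    in_aug_diagram g (i, k) -> in_aug_diagram g (j, k) ->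
    inversion_triple T (i, k) (j, k) (i, k.-1).

Definition type_B_ok (g : seq nat) (T : filling) : Prop :=
  forall i j k : nat, 0 < i -> i < j -> part g i < part g j ->
    in_aug_diagram g (i, k) -> in_aug_diagram g (j, k.+1) ->
    inversion_triple T (i, k) (j, k) (j, k.+1).

Definition aug_rows_decreasing (g : seq nat) (T : filling) : Prop :=
  forall i k : nat, in_aug_diagram g (i, k.+1) ->
    aug_entry T (i, k.+1) <= aug_entry T (i, k).

Definition SSAF (g : seq nat) : set filling :=
  [set T | [/\ shape T = g, positive_entries T & non_attacking g T] /\
           [/\ aug_rows_decreasing g T, type_A_ok g T & type_B_ok g T]].

Definition SAF (g : seq nat) : set filling :=
  [set T | SSAF g T /\ content T = seq_mset (iota 1 (sumn g))].

Definition dem_atom (g : seq nat) : fps :=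
  psum (SSAF g) (fun T => mono (content T)).

Definition quasi_schur (a : seq nat) : fps := psum (expansion a) dem_atom.

(** * Composition tableaux *)

Definition ComT (a : seq nat) : set filling :=
  [set T | [/\ shape T = a, positive_entries T,
      all (sorted geq) T,
      (forall i j, 0 < i -> i < j -> j <= size a -> entry T i 1 < entry T j 1)
    & (forall i j k, 0 < i -> i < j -> j <= size a ->
         2 <= k <= \max_(x <- a) x ->
         entry T j k != 0 -> entry T i k <= entry T j k ->
         entry T i k.-1 < entry T j k)]].

Definition standard_ComT (a : seq nat) : set filling :=
  [set T | ComT a T /\ perm_eq (flatten T) (iota 1 (sumn a))].

(** * The coefficients *)

(** [#|` fset_set A|] is the cardinal of a finite set [A]; finiteness of the two
    sets counted is [finite_d_SAF_set] and [finite_d_ComT_set]. *)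
Definition d_SAF_set (a b : seq nat) : set filling :=
  [set T | (exists2 g, expansion a g & SAF g T) /\ descent_composition T = b].

Definition d_SAF (a b : seq nat) : nat := #|` fset_set (d_SAF_set a b)|%fset.

Definition d_ComT_set (a b : seq nat) : set filling :=
  [set T | standard_ComT a T /\ descent_composition T = b].

Definition d_ComT (a b : seq nat) : nat := #|` fset_set (d_ComT_set a b)|%fset.

Definition composition_set : set (seq nat) := [set b | is_composition b].

(** * Well-definedness of the sums and cardinals above *)

Lemma finite_bounded_seqs (T : eqType) (l : seq T) (n : nat) :
  finite_set [set s : seq T | size s <= n /\ {subset s <= l}].
Proof.
elim: n => [|n IHn].
  apply: (sub_finite_set _ (finite_set1 [::])) => s /= [+ _].
  by rewrite leqn0 => /nilP.
apply: (@sub_finite_set _ _ ([set [::]] `|`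
  [set x :: s | x in [set` l] & s in
     [set s : seq T | size s <= n /\ {subset s <= l}]])).
  case=> [|x s] /= [sn sl]; first by left.
  right; exists x; first exact/sl/mem_head.
  by exists s => //; split=> // y ys; apply: sl; rewrite in_cons ys orbT.
rewrite finite_setU; split; first exact: finite_set1.
by apply: finite_image2.
Qed.

Lemma mono_neq0 (u m : monomial) : mono u m <> 0%R -> m = u.
Proof. by rewrite /mono; case: eqP. Qed.

Lemma content_perm (T : filling) (m : monomial) :
  m = content T -> perm_eq (flatten T) m.
Proof. by move=> ->; rewrite perm_sym; apply: perm_eq_seq_mset. Qed.

Lemma finite_fillings (G : set (seq nat)) (l : seq nat) : finite_set G ->
  finite_set [set T : filling | G (shape T) /\ perm_eq (flatten T) l].
Proof.
move=> finG; apply: (sub_finite_set _ (finite_image2 (fun g s => reshape g s)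
  finG (finite_bounded_seqs l (size l)))) => T /= [GT Tl].
exists (shape T) => //; exists (flatten T); last exact: flattenK.
by split=> [|x]; rewrite ?(perm_size Tl) // (perm_mem Tl).
Qed.

Lemma mem_M_term (a i : seq nat) (x : nat) :
  is_composition a -> size i = size a -> x \in i -> x \in M_term a i.
Proof.
rewrite /M_term; elim: i a => [|y i IHi] [|p a] //= /andP[p0 ca] [ia].
rewrite in_cons big_cons in_msetD in_msetn p0 /= => /orP[->//|xi].
by rewrite IHi ?orbT.
Qed.

Lemma summable_M (a : seq nat) : is_composition a ->
  summable (M_index a) (fun i => mono (M_term a i)).
Proof.
move=> ca m; apply: (sub_finite_set _ (finite_bounded_seqs m (size a))).
move=> i [[ia _ _] /mono_neq0 ->]; split; first by rewrite ia.
by move=> x; apply: mem_M_term.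
Qed.

Lemma leq_sumn (x : nat) (s : seq nat) : x \in s -> x <= sumn s.
Proof.
elim: s => //= y s IHs; rewrite in_cons => /orP[/eqP->|/IHs]; first exact: leq_addr.
by move=> /leq_trans; apply; apply: leq_addl.
Qed.

Lemma size_composition (b : seq nat) : is_composition b -> size b <= sumn b.
Proof. by elim: b => //= x b IHb /andP[x0 /IHb]; rewrite -addn1 addnC; apply: leq_add. Qed.

Lemma finite_F_index (a : seq nat) : finite_set (F_index a).
Proof.
apply: (sub_finite_set _ (finite_bounded_seqs (iota 0 (sumn a).+1) (sumn a))).
move=> b [cb [bs [_ bsb bsa]]].
have eqs : sumn b = sumn a.
  by rewrite -bsb -bsa; elim: (bs) => //= s ss <-; rewrite sumn_cat.
split; first by rewrite -eqs size_composition.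
by move=> x xb; rewrite mem_iota /= ltnS -eqs leq_sumn.
Qed.

Lemma summable_F (a : seq nat) : summable (F_index a) qsym_M.
Proof. by move=> m; apply: sub_finite_set (finite_F_index a) => b []. Qed.

Lemma summable_dem_atom (g : seq nat) :
  summable (SSAF g) (fun T => mono (content T)).
Proof.
move=> m; apply: (sub_finite_set _ (finite_fillings m (finite_set1 g))).
by move=> T [[[Tg _ _] _] /mono_neq0 mT]; split=> //; apply: content_perm.
Qed.

(** The first column of an SSAF repeats the basement. *)
Lemma SSAF_col1 (g : seq nat) (T : filling) (i : nat) :
  SSAF g T -> 0 < i <= size g -> 0 < part g i -> entry T i 1 = i.
Proof.
move=> [[Tg posT naT] [decT _ _]] iP gi.
have i1 : in_aug_diagram g (i, 1) by rewrite /in_aug_diagram /= iP.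
have := decT i 0 i1; rewrite /aug_entry /= leq_eqVlt => /orP[/eqP //|lti].
move: iP i1 => /andP[i0 ig] i1.
have gt0 : 0 < entry T i 1.
  have iT : i.-1 < size T by rewrite -(size_map size) -/(shape T) Tg prednK.
  move/allP: posT => /(_ (nth [::] T i.-1)) /(_ (mem_nth _ iT)) /allP; apply.
  apply: mem_nth; rewrite -(nth_map _ 0 size) //.
  by rewrite -/(shape T) Tg.
have : aug_entry T (i, 1) != aug_entry T (entry T i 1, 0).
  apply: naT; rewrite ?/attack ?xpair_eqE ?andbF //=.
  by rewrite /in_aug_diagram /= gt0 (leq_trans (ltnW lti)).
by rewrite /aug_entry /= eqxx.
Qed.

Lemma finite_expansions (a l : seq nat) : finite_set
  [set g | expansion a g /\ exists2 T, SSAF g T & perm_eq (flatten T) l].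
Proof.
apply: (sub_finite_set _ (finite_bounded_seqs (0 :: a) (sumn l))).
move=> g [[lastg ga] [T gT Tl]]; split.
  have [->//|g0] := eqVneq g [::].
  have sg : 0 < size g by case: (g) g0.
  have gP : 0 < part g (size g).
    by rewrite /part nth_last; case: (g) g0 lastg.
  have sgP : 0 < size g <= size g by rewrite sg leqnn.
  have := SSAF_col1 gT sgP gP; rewrite /entry => <-.
  apply: leq_sumn; rewrite -(perm_mem Tl).
  case: gT => [[Tg _ _] _].
  have iT : (size g).-1 < size T by rewrite -(size_map size) -/(shape T) Tg prednK.
  apply/flattenP; exists (nth [::] T (size g).-1); first exact: mem_nth.
  by apply: mem_nth; rewrite -(nth_map _ 0 size) // -/(shape T) Tg.
move=> x xg; rewrite in_cons -ga mem_filter xg andbT lt0n.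
by case: eqP.
Qed.

Lemma summable_quasi_schur (a : seq nat) : summable (expansion a) dem_atom.
Proof.
move=> m; apply: (sub_finite_set _ (finite_expansions a m)) => g [ag gm].
split=> //; apply: contrapT => noT; apply: gm.
rewrite /dem_atom /psum fsbig1 // => T gT.
apply: contrapT => /mono_neq0/content_perm Tm; apply: noT.
by exists T.
Qed.

Lemma sumn_compress (g : seq nat) : sumn (compress g) = sumn g.
Proof. by elim: g => //= -[|x] g IHg //=; rewrite IHg. Qed.

Lemma finite_SAFs (a : seq nat) :
  finite_set [set T | exists2 g, expansion a g & SAF g T].
Proof.
apply: (sub_finite_set _ (finite_fillings (iota 1 (sumn a))
  (finite_expansions a (iota 1 (sumn a))))) => T [g ag [gT cT]].
have Tl : perm_eq (flatten T) (iota 1 (sumn a)).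
  by case: ag => _ <-; rewrite sumn_compress; apply/eq_seq_msetP.
have Tg : shape T = g by case: gT => -[].
split=> //=; rewrite Tg; split=> //; by exists T.
Qed.

Lemma finite_d_SAF_set (a b : seq nat) : finite_set (d_SAF_set a b).
Proof. by apply: sub_finite_set (finite_SAFs a) => T []. Qed.

Lemma finite_d_ComT_set (a b : seq nat) : finite_set (d_ComT_set a b).
Proof.
apply: (sub_finite_set _ (finite_fillings (iota 1 (sumn a)) (finite_set1 a))).
by move=> T [[[Ta _ _ _ _] ?] _].
Qed.

Lemma summable_expansion_F (a : seq nat) :
  summable composition_set (fun b => (qsym_F b *+ d_SAF a b)%R).
Proof.
move=> m; apply: (sub_finite_set _ (finite_image descent_composition (finite_SAFs a))).
move=> b [_ bm]; apply: contrapT => noT; apply: bm.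
suff -> : d_SAF a b = 0 by rewrite mulr0n.
rewrite /d_SAF (_ : d_SAF_set a b = set0) ?fset_set0 ?cardfs0 //.
by apply/seteqP; split=> // T [aT Tb]; apply: noT; exists T.
Qed.

(* Main.v *)
(** Including the basement, any two rows of an SSAF satisfy the triple rule of ComTs,
    and this rule together with weakly decreasing rows already implies the
    non-attacking, type A and type B conditions. As the first column repeats the
    basement, deleting the empty rows is a content- and column-preserving bijection
    from the SSAFs whose shape expands [a] onto the ComTs of shape [a]; its inverse
    puts each row back at the height given by its first entry. This identifies the two
    counts [d_SAF] and [d_ComT], and reduces the expansion to ComTs.

    The entries of a column of a ComT are distinct, so its cells can be numbered by
    increasing entry, equal entries being numbered from right to left. This
    standardization is again a ComT, and for a monomial [m] with sorted word [w] it
    identifies the ComTs of content [m] with the standard ComTs [S] such that [w]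
    increases strictly at each descent of [S]. The latter condition says that the
    descent composition of [S] is a coarsening of the exponents of [m], i.e. that [m]
    occurs, with coefficient 1, in the fundamental function of [S]. *)

Require Import Defs.
From mathcomp Require Import all_boot all_order all_algebra.
From mathcomp Require Import finmap multiset.
From mathcomp Require Import boolp classical_sets functions cardinality fsbigop.
From mathcomp Require Import zify.

Set Implicit Arguments.
Unset Strict Implicit.
Unset Printing Implicit Defensive.

Import Order.TTheory GRing.Theory.

Local Open Scope classical_set_scope.
Local Open Scope nat_scope.

(** * Sequences, bijections and finite sums *)

Lemma all_flatten (T : Type) (p : pred T) (ss : seq (seq T)) :
  all p (flatten ss) = all (all p) ss.
Proof. by elim: ss => //= s ss IHss; rewrite all_cat IHss. Qed.

Lemma leq_nth_sorted_geq (s : seq nat) (i j : nat) :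
  sorted geq s -> i <= j -> nth 0 s j <= nth 0 s i.
Proof.
move=> ds ij; have [sj|js] := leqP (size s) j; first by rewrite nth_default.
have geq_trans : transitive geq by move=> y x z xy /leq_trans; apply.
by apply: (sorted_leq_nth geq_trans leqnn 0 ds); rewrite ?inE // (leq_ltn_trans ij).
Qed.

Lemma map_nth_iota1 (T : Type) (x : T) (s : seq T) :
  [seq nth x s p.-1 | p <- iota 1 (size s)] = s.
Proof. by rewrite (iotaDl 1 0) -map_comp map_nth_iota0 // take_size. Qed.

Lemma map_index_uniq (T : eqType) (s : seq T) : uniq s ->
  [seq index x s | x <- s] = iota 0 (size s).
Proof.
case: s => // x0 s s_uniq; apply: (@eq_from_nth _ 0).
  by rewrite size_map size_iota.
by move=> i; rewrite size_map => i_s; rewrite (nth_map x0) // index_uniq // nth_iota.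
Qed.

Lemma index_lt_sorted (disp : Order.disp_t) (T : porderType disp) (s : seq T) :
  sorted <%O s -> {in s &, forall x y, (index x s < index y s) = (x < y)%O}.
Proof.
move=> s_inc x y xs ys; rewrite -[in RHS](nth_index x xs) -[in RHS](nth_index x ys).
by rewrite (lt_sorted_ltn_nth x) ?inE ?index_mem.
Qed.

Lemma set_bij_can (T U : Type) (A : set T) (B : set U) (f : T -> U) (g : U -> T) :
  set_fun A B f -> set_fun B A g -> {in A, cancel f g} -> {in B, cancel g f} ->
  set_bij A B f.
Proof.
move=> fAB gBA fK gK; split=> //; first exact: can_in_inj fK.
by move=> y By; exists (g y); [exact: gBA | exact/gK/mem_set].
Qed.

Lemma set_bij_setI_preimage (T U : Type) (A : set T) (B P : set U) (f : T -> U) :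
  set_bij A B f -> set_bij (A `&` f @^-1` P) (B `&` P) f.
Proof.
move=> [fAB f_inj f_surj]; split=> [x [Ax Px]|x y|_ [/f_surj[x Ax <-] Px]].
- by split; first exact: fAB.
- by rewrite !inE => -[Ax _] [Ay _]; apply: f_inj; rewrite inE.
- by exists x.
Qed.

Lemma card_fset_set_bij (T U : choiceType) (A : set T) (B : set U) (f : T -> U) :
  finite_set A -> set_bij A B f -> #|` fset_set A|%fset = #|` fset_set B|%fset.
Proof.
move=> finA [fAB f_inj f_surj].
have <- : f @` A = B by apply/seteqP; split=> // _ [x /fAB Bfx <-].
rewrite fset_set_image // card_in_imfset // => x y.
by rewrite !in_fset_set //; apply: f_inj.
Qed.

Lemma partition_fsbig (R : Type) (idx : R) (op : Monoid.com_law idx) (I J : choiceType)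
    (X : set I) (A : set J) (f : I -> J) (F : I -> R) :
  finite_set (X `&` F @^-1` [set~ idx]) -> set_fun X A f ->
  \big[op/idx]_(x \in X) F x =
  \big[op/idx]_(j \in A) \big[op/idx]_(x \in X `&` f @^-1` [set j]) F x.
Proof.
rewrite fsbig_supp; set S := X `&` F @^-1` _ => finS fXA.
have fiberE j : \big[op/idx]_(x \in X `&` f @^-1` [set j]) F x =
                \big[op/idx]_(x \in S) if x \in f @^-1` [set j] then F x else idx.
  by rewrite fsbig_supp setIAC -fsbig_mkcondr.
under [RHS]eq_fsbigr do rewrite fiberE.
rewrite -(@fsbig_widen _ _ _ _ (f @` S)) /=; first last.
- move=> j [_ not_fS] /=; apply: fsbig1 => x Sx; case: ifP => // fx.
  by case: not_fS; exists x => //; apply/set_mem.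
- by move=> _ [x [Xx _] <-]; apply: fXA.
rewrite exchange_fsbig //; last exact: finite_image.
apply: eq_fsbigr => x; rewrite inE => Sx.
rewrite -(@fsbig_widen _ _ _ _ [set f x]).
- by rewrite fsbig_set1 ifT // inE.
- by move=> _ ->; exists x.
- by move=> j [_ /= jfx]; rewrite ifF //; apply/negbTE/negP; rewrite inE => /esym.
Qed.

Lemma fsum_const (V : nmodType) (I : choiceType) (X : set I) (v : V) : finite_set X ->
  (\sum_(x \in X) v = v *+ #|` fset_set X|%fset)%R.
Proof.
by move=> finX; rewrite fsbig_finite //= big_const_seq count_predT iter_addr_0.
Qed.

Lemma fsum_indicator (R : pzSemiRingType) (I : choiceType) (A P : set I) :
  (\sum_(x \in A) (`[< P x >]%:R : R) = \sum_(x \in A `&` P) (1 : R))%R.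
Proof.
rewrite fsbig_mkcondr; apply: eq_fsbigr => x _.
by rewrite -[asbool _]/(x \in P); case: (x \in P).
Qed.

(** * Fillings by rows *)

(* The last condition on ComTs, for a row [r] above a row [s], with columns numbered
   from 0. Here [nth] pads [r] with zeros, and as entries are positive, the nonzero
   T(j,k) are the cells of [s]. *)
Definition triple_rule (r s : seq nat) : bool :=
  [forall k : 'I_(size s).-1,
     (nth 0 r k.+1 <= nth 0 s k.+1) ==> (nth 0 r k < nth 0 s k.+1)].

Lemma triple_ruleP (r s : seq nat) :
  reflect (forall k, k.+1 < size s -> nth 0 r k.+1 <= nth 0 s k.+1 ->
             nth 0 r k < nth 0 s k.+1)
          (triple_rule r s).
Proof.
apply: (iffP forallP) => [rs k ks|rs k]; last by apply/implyP/rs; case: k => /=; lia.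
have ks' : k < (size s).-1 by lia.
exact/implyP/(rs (Ordinal ks')).
Qed.

Lemma triple_rule_nil_right (r : seq nat) : triple_rule r [::].
Proof. exact/triple_ruleP. Qed.

Lemma triple_rule_nil_left (s : seq nat) : all (leq 1) s -> triple_rule [::] s.
Proof. by move=> /(all_nthP 0) s0; apply/triple_ruleP => k /s0; rewrite !nth_nil. Qed.

Lemma triple_rule_cons (x y : nat) (r s : seq nat) :
  triple_rule (x :: r) (y :: s) <->
  (s != [::] -> nth 0 r 0 <= nth 0 s 0 -> x < nth 0 s 0) /\ triple_rule r s.
Proof.
split=> [/triple_ruleP rs|[rs0 /triple_ruleP rs]].
  split=> [s0|]; first by apply: (rs 0); rewrite /= ltnS lt0n size_eq0.
  by apply/triple_ruleP => k; apply: (rs k.+1).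
apply/triple_ruleP => -[|k]; last exact: rs.
by rewrite /= ltnS lt0n size_eq0.
Qed.

Lemma triple_rule_column_neq (r s : seq nat) (k : nat) :
  sorted geq r -> triple_rule r s -> k.+1 < size s -> nth 0 r k.+1 != nth 0 s k.+1.
Proof.
move=> r_dec /triple_ruleP rs ks; have := rs k ks.
by have := leq_nth_sorted_geq r_dec (leqnSn k); lia.
Qed.

Lemma triple_rule_diagonal_neq (r s : seq nat) (k : nat) :
  sorted geq r -> triple_rule r s -> k.+1 < size s -> nth 0 r k != nth 0 s k.+1.
Proof.
move=> r_dec /triple_ruleP rs ks; have := rs k ks.
by have := leq_nth_sorted_geq r_dec (leqnSn k); lia.
Qed.

(* Downward induction on the column, starting past the end of [r], where [nth]
   gives 0. *)
Lemma triple_rule_longer_lower (r s : seq nat) (k : nat) :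
  sorted geq s -> triple_rule r s -> size r < size s -> k.+1 < size s ->
  nth 0 r k < nth 0 s k.+1.
Proof.
move=> s_dec /triple_ruleP rs rs_size ks.
have [d sE] : exists d, size s = d + k.+2 by exists (size s - k.+2); rewrite subnK.
elim: d k ks sE => [|d IHd] k ks sE; apply: rs => //.
  by rewrite nth_default //; lia.
have /ltnW/leq_trans : nth 0 r k.+1 < nth 0 s k.+2 by apply: IHd; lia.
by apply; apply: leq_nth_sorted_geq.
Qed.

Lemma triple_rule_of_longer_lower (r s : seq nat) :
  sorted geq r -> all (leq 1) s -> nth 0 r 0 <= nth 0 s 0 ->
  (forall k, k < size r -> nth 0 r k <= nth 0 s k -> nth 0 r k < nth 0 s k.+1) ->
  triple_rule r s.
Proof.
move=> r_dec /(all_nthP 0) s_pos rs0 rs; apply/triple_ruleP => k ks _.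
have [rk|kr] := leqP (size r) k; first by rewrite nth_default // s_pos.
elim: k {ks} kr => [|k IHk] kr; first exact: rs.
apply: rs => //; apply: leq_trans (leq_nth_sorted_geq r_dec (leqnSn k)) _.
exact/ltnW/IHk/ltnW.
Qed.

Definition aug_row (T : filling) (i : nat) : seq nat := i.+1 :: nth [::] T i.

Lemma aug_entryE (T : filling) (i k : nat) :
  aug_entry T (i.+1, k) = nth 0 (aug_row T i) k.
Proof. by case: k. Qed.

Lemma part_shape (T : filling) (i : nat) : part (shape T) i.+1 = size (nth [::] T i).
Proof.
rewrite /part /shape /=; have [iT|iT] := ltnP i (size T); first exact: nth_map.
by rewrite !nth_default ?size_map.
Qed.

Lemma in_aug_diagram_shape (T : filling) (i k : nat) :
  in_aug_diagram (shape T) (i.+1, k) = (i < size T) && (k < size (aug_row T i)).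
Proof. by rewrite /in_aug_diagram /= part_shape size_map. Qed.

Lemma inversion_triple_A (T : filling) (i j k : nat) :
  i < j -> aug_entry T (i, k.+1) <= aug_entry T (i, k) ->
  inversion_triple T (i, k.+1) (j, k.+1) (i, k) =
  (aug_entry T (i, k.+1) <= aug_entry T (j, k.+1)) ==>
    (aug_entry T (i, k) < aug_entry T (j, k.+1)).
Proof. by rewrite /inversion_triple /cell_lt /read_before /=; lia. Qed.

Lemma inversion_triple_B (T : filling) (i j k : nat) :
  i < j -> aug_entry T (j, k.+1) <= aug_entry T (j, k) ->
  inversion_triple T (i, k) (j, k) (j, k.+1) =
  (aug_entry T (i, k) <= aug_entry T (j, k)) ==>
    (aug_entry T (i, k) < aug_entry T (j, k.+1)).
Proof. by rewrite /inversion_triple /cell_lt /read_before /=; lia. Qed.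

Lemma aug_rows_decreasingP (T : filling) :
  aug_rows_decreasing (shape T) T <->
  forall i, i < size T -> sorted geq (aug_row T i).
Proof.
split=> [T_dec i iT|T_dec [//|i] k].
  apply/(sortedP 0) => k ki; rewrite -!aug_entryE.
  by apply: T_dec; rewrite in_aug_diagram_shape iT.
rewrite in_aug_diagram_shape !aug_entryE => /andP[iT _].
exact: leq_nth_sorted_geq (T_dec i iT) (leqnSn k).
Qed.

Lemma SSAF_triple_rule (T : filling) (i j : nat) : SSAF (shape T) T -> i < j < size T ->
  triple_rule (aug_row T i) (aug_row T j).
Proof.
move=> [[_ T_pos _] [/aug_rows_decreasingP T_dec T_A T_B]] /andP[ij jT].
have iT := ltn_trans ij jT; have ji : i.+1 < j.+1 by [].
have dec l k : l < size T -> aug_entry T (l.+1, k.+1) <= aug_entry T (l.+1, k).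
  by move=> lT; rewrite !aug_entryE; apply: leq_nth_sorted_geq (T_dec l lT) _.
have [sji|sij] := leqP (size (nth [::] T j)) (size (nth [::] T i)).
  apply/triple_ruleP => k kj; rewrite -!aug_entryE.
  have := T_A i.+1 j.+1 k.+1; rewrite !part_shape !in_aug_diagram_shape iT jT.
  rewrite inversion_triple_A ?dec // => inv_A; apply/implyP/inv_A => //.
  exact: leq_trans kj _.
apply: triple_rule_of_longer_lower (T_dec i iT) _ _ _ => [||k ki].
- by rewrite /= (allP T_pos) ?mem_nth.
- exact: ltnW.
rewrite -!aug_entryE; have := T_B i.+1 j.+1 k.
rewrite !part_shape !in_aug_diagram_shape iT jT inversion_triple_B ?dec //.
by move=> inv_B; apply/implyP/inv_B => //; apply: leq_ltn_trans ki _.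
Qed.

Section SSAFOfTripleRule.
Variable T : filling.
Hypotheses (T_dec : forall i, i < size T -> sorted geq (aug_row T i))
  (T_triple : forall i j, i < j < size T -> triple_rule (aug_row T i) (aug_row T j)).

Lemma triple_rule_non_attacking : non_attacking (shape T) T.
Proof.
move=> [[|i] k] [[|j] l] //; rewrite !in_aug_diagram_shape xpair_eqE eqSS !aug_entryE.
move=> /andP[iT ki] /andP[jT lj] neq; rewrite /attack /= => /orP[/eqP ekl|].
  rewrite -{l}ekl eqxx andbT in lj neq *.
  wlog ij : i j iT ki jT lj {neq} / i < j.
    move=> IH; move: neq; rewrite neq_ltn => /orP[|ji]; first exact: IH.
    by rewrite eq_sym IH.
  case: k ki lj => [|k] _ kj; first by rewrite neq_ltn /= ltnS ij.
  by apply: triple_rule_column_neq => //; [apply: T_dec | apply: T_triple; rewrite ij].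
rewrite ltnS => /andP[/eqP ekl ji]; rewrite {}ekl in ki *; rewrite eq_sym.
by apply: triple_rule_diagonal_neq => //; [apply: T_dec | apply: T_triple; rewrite ji].
Qed.

Lemma triple_rule_type_A_ok : type_A_ok (shape T) T.
Proof.
move=> [//|i] [//|j] [//|k] _ ij _ _; rewrite !in_aug_diagram_shape.
move=> /andP[iT ki] /andP[jT kj].
rewrite inversion_triple_A // !aug_entryE; last first.
  exact: leq_nth_sorted_geq (T_dec iT) (leqnSn k).
have ijT : i < j < size T by rewrite -ltnS ij.
exact/implyP/(triple_ruleP _ _ (T_triple ijT)).
Qed.

Lemma triple_rule_type_B_ok : type_B_ok (shape T) T.
Proof.
move=> [//|i] [//|j] k _ ij; rewrite !part_shape => sij; rewrite !in_aug_diagram_shape.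
move=> /andP[iT ki] /andP[jT kj].
rewrite inversion_triple_B // !aug_entryE; last first.
  exact: leq_nth_sorted_geq (T_dec jT) (leqnSn k).
apply/implyP => _; apply: triple_rule_longer_lower => //; first exact: T_dec.
by apply: T_triple; rewrite -ltnS ij.
Qed.

End SSAFOfTripleRule.

Definition first_column (T : filling) : seq nat := [seq head 0 r | r <- T].

(* [n] is the number of rows above [T]. *)
Definition repeats_basement (n : nat) (T : filling) : Prop :=
  forall i, nth [::] T i != [::] -> head 0 (nth [::] T i) = (n + i).+1.

Lemma repeats_basement_cons (n : nat) (r : seq nat) (T : filling) :
  repeats_basement n (r :: T) <->
  (r != [::] -> head 0 r = n.+1) /\ repeats_basement n.+1 T.
Proof.
split=> [rT_bas|[r_head T_bas]].
  by split=> [/(rT_bas 0)|i /(rT_bas i.+1)]; rewrite ?addn0 // -addSnnS.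
by case=> [|i]; [rewrite addn0 | rewrite -addSnnS; apply: T_bas].
Qed.

Lemma SSAF_rowsP (T : filling) : SSAF (shape T) T <->
  [/\ positive_entries T, all (sorted geq) T, repeats_basement 0 T
    & pairwise triple_rule T].
Proof.
split=> [T_SSAF|[T_pos /(all_nthP [::]) T_dec T_bas /(pairwiseP [::]) T_triple]].
  have [[_ T_pos _] [/aug_rows_decreasingP T_dec _ _]] := T_SSAF; split=> //.
  - by apply/(all_nthP [::]) => i /T_dec /path_sorted.
  - move=> i; have [iT|iT] := ltnP i (size T); last by rewrite nth_default.
    rewrite -size_eq0 -lt0n -nth0 => Ti.
    by have := @SSAF_col1 _ T i.+1 T_SSAF; rewrite part_shape size_map; apply.
  - apply/(pairwiseP [::]) => i j _ jT ij.
    have /(SSAF_triple_rule T_SSAF) : i < j < size T by rewrite ij.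
    by case/triple_rule_cons.
have aug_dec i : i < size T -> sorted geq (aug_row T i).
  move=> /T_dec; rewrite /aug_row; have := T_bas i.
  by case: (nth [::] T i) => //= x r /(_ isT) -> ->; rewrite leqnn.
have aug_triple i j : i < j < size T -> triple_rule (aug_row T i) (aug_row T j).
  move=> /andP[ij jT]; apply/triple_rule_cons; split.
    by move=> /T_bas; rewrite !nth0 => ->.
  exact: T_triple (ltn_trans ij jT) jT ij.
split; split=> //.
- exact: triple_rule_non_attacking.
- exact/aug_rows_decreasingP.
- exact: triple_rule_type_A_ok.
- exact: triple_rule_type_B_ok.
Qed.

Lemma ComT_rowsP (a : seq nat) (T : filling) :
  ComT a T <-> [/\ shape T = a, positive_entries T, all (sorted geq) T,
                   sorted ltn (first_column T) & pairwise triple_rule T].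
Proof.
rewrite (sorted_pairwise ltn_trans) pairwise_map.
split=> -[Ta T_pos T_dec T_col T_triple]; split=> //;
  have sT : size T = size a by rewrite -Ta size_map.
- apply/(pairwiseP [::]) => i j _ jT ij /=; rewrite -!nth0.
  by apply: (T_col i.+1 j.+1); rewrite // -sT.
- apply/(pairwiseP [::]) => i j _ jT ij; apply/triple_ruleP => k kj.
  apply: (T_triple i.+1 j.+1 k.+2); rewrite // ?sT -?lt0n.
  + by rewrite -sT.
  + apply: leq_trans kj _; rewrite -Ta; apply: leq_bigmax_seq => //.
    exact/map_f/mem_nth.
  + by apply: (all_nthP 0 _ _ kj); apply: (allP T_pos); apply: mem_nth.
- move=> [//|i] [//|j] _ ij; rewrite -sT /entry /= !nth0 => jT.
  by move/(pairwiseP [::]): T_col; apply=> //; apply: ltn_trans jT.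
- move=> [//|i] [//|j] [|[|k]] // _ ij; rewrite -sT /entry /= => jT _ jk.
  have iT : i < size T by apply: ltn_trans jT.
  move/(pairwiseP [::]): T_triple => /(_ i j iT jT ij) /triple_ruleP.
  by apply; rewrite ltnNge; apply: contra jk => /(nth_default 0) ->.
Qed.

(** * Deleting the empty rows *)

Definition drop_empty (T : filling) : filling := [seq r <- T | r != [::]].

Fixpoint insert_empty (n : nat) (U : filling) : filling :=
  if U is r :: U' then
    nseq (head 0 r - n.+1) [::] ++ r :: insert_empty (head 0 r) U'
  else [::].

Lemma shape_drop_empty (T : filling) : shape (drop_empty T) = compress (shape T).
Proof. by elim: T => //= -[|x r] T //= ->. Qed.

Lemma flatten_drop_empty (T : filling) : flatten (drop_empty T) = flatten T.
Proof. by elim: T => //= -[|x r] T //= ->. Qed.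

Lemma column_drop_empty (T : filling) (v : nat) : column (drop_empty T) v = column T v.
Proof. by congr _.+1; elim: T => //= -[|x r] T IHT //=; case: ifP. Qed.

Lemma descent_composition_drop_empty (T : filling) :
  descent_composition (drop_empty T) = descent_composition T.
Proof.
rewrite /descent_composition /descents flatten_drop_empty; congr beta.
by apply: eq_filter => i; rewrite !column_drop_empty.
Qed.

Lemma first_column_drop_empty (n : nat) (T : filling) :
  repeats_basement n T -> path ltn n (first_column (drop_empty T)).
Proof.
elim: T n => //= r T IHT n /repeats_basement_cons[r_head /IHT T_path].
case: ifP => [/r_head /= ->|_]; first by rewrite leqnn.
exact: (path_le ltn_trans (ltnSn n)).
Qed.

Lemma insert_emptyK (n : nat) (U : filling) :
  [::] \notin U -> drop_empty (insert_empty n U) = U.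
Proof.
elim: U n => //= r U IHU n; rewrite in_cons negb_or eq_sym => /andP[r0 U0].
by rewrite /drop_empty filter_cat filter_nseq /= r0 -/(drop_empty _) IHU.
Qed.

Lemma drop_emptyK (n : nat) (T : filling) : repeats_basement n T ->
  0 < last 1 (shape T) -> insert_empty n (drop_empty T) = T.
Proof.
elim: T n => //= r T IHT n /repeats_basement_cons[r_head T_bas] T_last.
case: ifP => [/r_head {}r_head|/negbFE/eqP r0] /=.
  by rewrite r_head subnn IHT //; case: T {IHT T_bas} T_last.
have {}T_last : 0 < last 1 (shape T) /\ T != [::].
  by rewrite r0 in T_last; case: T {IHT T_bas} T_last.
have := first_column_drop_empty T_bas; have := IHT n.+1 T_bas T_last.1.
case: (drop_empty T) => [T0|s U /= <- /andP[ns _]]; last by rewrite r0 -(subnSK ns).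
by rewrite -T0 in T_last; case: T_last.
Qed.

Lemma last_shape_insert_empty (n x : nat) (U : filling) :
  [::] \notin U -> 0 < x -> 0 < last x (shape (insert_empty n U)).
Proof.
elim: U n x => //= r U IHU n x; rewrite in_cons negb_or eq_sym => /andP[r0 U0] _.
by rewrite /shape map_cat last_cat /= IHU // lt0n size_eq0.
Qed.

Lemma repeats_basement_nseq (n d : nat) (T : filling) :
  repeats_basement (n + d) T -> repeats_basement n (nseq d [::] ++ T).
Proof.
elim: d n => [|d IHd] n; first by rewrite addn0.
by rewrite -addSnnS => /IHd T_bas; apply/repeats_basement_cons.
Qed.

Lemma repeats_basement_insert_empty (n : nat) (U : filling) :
  path ltn n (first_column U) -> repeats_basement n (insert_empty n U).
Proof.
elim: U n => [|r U IHU] n /=; first by move=> _ i; rewrite nth_nil.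
move=> /andP[nr /IHU U_bas]; apply/repeats_basement_nseq/repeats_basement_cons.
by have -> : (n + (head 0 r - n.+1)).+1 = head 0 r by lia.
Qed.

Lemma all_insert_empty (p : pred (seq nat)) (n : nat) (U : filling) :
  p [::] -> all p (insert_empty n U) = all p U.
Proof.
by move=> p0; elim: U n => //= r U IHU n; rewrite all_cat all_nseq p0 orbT /= IHU.
Qed.

Lemma triple_rule_insert_empty (n : nat) (U : filling) : positive_entries U ->
  pairwise triple_rule U -> pairwise triple_rule (insert_empty n U).
Proof.
elim: U n => // r U IHU n /= /andP[r_pos U_pos] /andP[rU UU].
have nil_triple : all (triple_rule [::]) (r :: insert_empty (head 0 r) U).
  rewrite /= all_insert_empty ?triple_rule_nil_right // triple_rule_nil_left //.
  by apply: sub_all U_pos; apply: triple_rule_nil_left.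
elim: (_ - _) => [|d IHd] /=.
  by rewrite all_insert_empty ?triple_rule_nil_right ?rU ?IHU.
by rewrite IHd all_cat nil_triple all_nseq triple_rule_nil_right orbT.
Qed.

Definition SSAF_expanding (a : seq nat) : set filling :=
  [set T | exists2 g, expansion a g & SSAF g T].

Lemma SSAF_expandingP (a : seq nat) (T : filling) :
  SSAF_expanding a T <-> expansion a (shape T) /\ SSAF (shape T) T.
Proof.
split=> [[g ag gT]|[aT T_SSAF]]; last by exists (shape T).
by have -> : shape T = g by case: gT => -[].
Qed.

Lemma SSAF_expanding_drop_emptyK (a : seq nat) :
  {in SSAF_expanding a, cancel drop_empty (insert_empty 0)}.
Proof.
move=> T /set_mem /SSAF_expandingP[[T_last _] /SSAF_rowsP[_ _ T_bas _]].
exact: drop_emptyK.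
Qed.

Lemma ComT_drop_empty (a : seq nat) (T : filling) :
  SSAF_expanding a T -> ComT a (drop_empty T).
Proof.
move=> /SSAF_expandingP[[_ Ta] /SSAF_rowsP[T_pos T_dec T_bas T_triple]].
apply/ComT_rowsP; split; first by rewrite shape_drop_empty.
- rewrite /positive_entries all_filter.
  by apply: sub_all T_pos => r /= ->; rewrite implybT.
- by rewrite all_filter; apply: sub_all T_dec => r /= ->; rewrite implybT.
- exact: path_sorted (first_column_drop_empty T_bas).
- exact: pairwise_filter.
Qed.

Lemma ComT_rows_neq_nil (a : seq nat) (T : filling) :
  is_composition a -> ComT a T -> [::] \notin T.
Proof.
move=> a_comp [Ta _ _ _ _]; apply/negP => /(map_f size).
by rewrite -/(shape T) Ta => /(allP a_comp).
Qed.

Lemma SSAF_insert_empty (a : seq nat) (U : filling) : is_composition a ->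
  ComT a U -> SSAF_expanding a (insert_empty 0 U).
Proof.
move=> a_comp aU; have U0 := ComT_rows_neq_nil a_comp aU.
case/ComT_rowsP: aU => Ua U_pos U_dec U_col U_triple; apply/SSAF_expandingP; split.
  by split; [exact: last_shape_insert_empty | rewrite -shape_drop_empty insert_emptyK].
apply/SSAF_rowsP; split; rewrite /positive_entries ?all_insert_empty //.
  apply: repeats_basement_insert_empty.
  case: U U0 U_pos U_col {Ua U_dec U_triple} => //.
  by move=> [|x r] U //= _ /andP[/andP[-> _] _].
exact: triple_rule_insert_empty.
Qed.

Lemma drop_empty_bij (a : seq nat) : is_composition a ->
  set_bij (SSAF_expanding a) (ComT a) drop_empty.
Proof.
move=> a_comp; apply: (set_bij_can (g := insert_empty 0)).
- exact: ComT_drop_empty.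
- by move=> U; apply: SSAF_insert_empty.
- exact: SSAF_expanding_drop_emptyK.
- by move=> U /set_mem /(ComT_rows_neq_nil a_comp); apply: insert_emptyK.
Qed.

(** * Standardization *)

(* An entry is tagged with its column. Equal entries are ordered from right to
   left, so that no descent separates the numbers that standardization gives them. *)
Local Notation tagged := (nat *l nat^d)%type.

Lemma tagged_ltE (c d : tagged) :
  (c < d)%O = (c.1 < d.1) || ((c.1 == d.1) && (d.2 < c.2)).
Proof. by rewrite ltEprodlexi ltEdual !ltEnat !leEnat /=; lia. Qed.

Definition tag_columns (r : seq nat) : seq tagged := zip r (iota 1 (size r)).

Definition tagged_entries (T : filling) : seq tagged :=
  flatten [seq tag_columns r | r <- T].

Definition map_tagged (f : tagged -> nat) (T : filling) : filling :=
  [seq [seq f c | c <- tag_columns r] | r <- T].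

Lemma unzip1_tag_columns (r : seq nat) : unzip1 (tag_columns r) = r.
Proof. by rewrite unzip1_zip // size_iota. Qed.

Lemma size_tag_columns (r : seq nat) : size (tag_columns r) = size r.
Proof. by rewrite size_zip size_iota minnn. Qed.

Lemma nth_tag_columns (c : tagged) (r : seq nat) (k : nat) : k < size r ->
  nth c (tag_columns r) k = (nth 0 r k, k.+1).
Proof.
case: c => v l kr; rewrite nth_zip ?size_iota // nth_iota //.
by congr pair; apply: set_nth_default.
Qed.

Lemma tag_columnsP (r : seq nat) (c : tagged) :
  reflect (exists2 k, k < size r & c = (nth 0 r k, k.+1)) (c \in tag_columns r).
Proof.
apply: (iffP (nthP c)) => -[k]; rewrite ?size_tag_columns => kr.
  by move=> <-; exists k; rewrite ?nth_tag_columns.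
by move=> ->; exists k; rewrite ?size_tag_columns ?nth_tag_columns.
Qed.

Lemma uniq_tag_columns (r : seq nat) : uniq (tag_columns r).
Proof.
apply: (@map_uniq _ _ snd); rewrite -/(unzip2 _).
by rewrite unzip2_zip ?size_iota ?iota_uniq.
Qed.

Lemma tag_columns_map (f : tagged -> nat) (r : seq nat) :
  tag_columns [seq f c | c <- tag_columns r] = [seq (f c, c.2) | c <- tag_columns r].
Proof.
rewrite /tag_columns size_map -/(tag_columns r) size_tag_columns.
have {1}-> : iota 1 (size r) = unzip2 (tag_columns r) by rewrite unzip2_zip ?size_iota.
by rewrite zip_map.
Qed.

Lemma tagged_entries_map (f : tagged -> nat) (T : filling) :
  tagged_entries (map_tagged f T) = [seq (f c, c.2) | c <- tagged_entries T].
Proof.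
rewrite /tagged_entries /map_tagged map_flatten -!map_comp; congr flatten.
by apply: eq_map => r /=; rewrite tag_columns_map.
Qed.

Lemma unzip1_tagged_entries (T : filling) : unzip1 (tagged_entries T) = flatten T.
Proof.
rewrite /unzip1 /tagged_entries map_flatten -map_comp; congr flatten.
by rewrite -[RHS]map_id; apply: eq_map => r /=; rewrite -/unzip1 unzip1_tag_columns.
Qed.

Lemma flatten_map_tagged (f : tagged -> nat) (T : filling) :
  flatten (map_tagged f T) = [seq f c | c <- tagged_entries T].
Proof. by rewrite map_flatten -map_comp. Qed.

Lemma map_tagged_comp (f g : tagged -> nat) (T : filling) :
  map_tagged f (map_tagged g T) = map_tagged (fun c => f (g c, c.2)) T.
Proof.
rewrite /map_tagged -map_comp; apply: eq_map => r /=.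
by rewrite tag_columns_map -map_comp.
Qed.

Lemma map_tagged_id_in (f : tagged -> nat) (T : filling) :
  {in tagged_entries T, f =1 fst} -> map_tagged f T = T.
Proof.
move=> fT; rewrite -[RHS]map_id; apply/eq_in_map => r rT.
rewrite -[RHS]unzip1_tag_columns; apply/eq_in_map => c cr; apply: fT.
by apply/flatten_mapP; exists r.
Qed.

Lemma shape_map_tagged (f : tagged -> nat) (T : filling) :
  shape (map_tagged f T) = shape T.
Proof.
rewrite /shape /map_tagged -map_comp; apply: eq_map => r /=.
by rewrite size_map size_tag_columns.
Qed.

Lemma nth_map_tagged (f : tagged -> nat) (T : filling) (i k : nat) :
  nth 0 (nth [::] (map_tagged f T) i) k =
  if k < size (nth [::] T i) then f (nth 0 (nth [::] T i) k, k.+1) else 0.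
Proof.
have rowE : nth [::] (map_tagged f T) i = [seq f c | c <- tag_columns (nth [::] T i)].
  have [iT|Ti] := ltnP i (size T); first by rewrite (nth_map [::]).
  by rewrite !nth_default ?size_map.
rewrite rowE; case: ltnP => ki; last by rewrite nth_default ?size_map ?size_tag_columns.
by rewrite (nth_map (0, 0)) ?size_tag_columns ?nth_tag_columns.
Qed.

Lemma mem_tagged_entries (T : filling) (i k : nat) : k < size (nth [::] T i) ->
  (nth 0 (nth [::] T i) k, k.+1) \in tagged_entries T.
Proof.
move=> ki; have iT : i < size T.
  by rewrite ltnNge; apply/negP => iT; rewrite nth_default in ki.
apply/flatten_mapP; exists (nth [::] T i); first exact: mem_nth.
by apply/tag_columnsP; exists k.
Qed.

Lemma column_tagged_entries (T : filling) (v k : nat) :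
  uniq (flatten T) -> (v, k) \in tagged_entries T -> column T v = k.
Proof.
rewrite /column; elim: T => //= r T IHT; rewrite cat_uniq => /and3P[ur rT uT].
rewrite /tagged_entries /= mem_cat => /orP[/tag_columnsP[l lr [-> ->]]|vT].
  by rewrite mem_nth //= index_uniq.
have /negPf -> /= : v \notin r; last exact: IHT.
apply: contra rT => vr; apply/hasP; exists v => //=.
by rewrite -unzip1_tagged_entries; apply/mapP; exists (v, k).
Qed.

Lemma tagged_entries_column (T : filling) : uniq (flatten T) ->
  tagged_entries T = [seq (v, column T v) | v <- flatten T].
Proof.
move=> uT; rewrite -unzip1_tagged_entries -map_comp -[LHS]map_id.
by apply/eq_in_map => -[v k] /(column_tagged_entries uT) <-.
Qed.

Lemma ltn_nth_map_tagged (f : tagged -> nat) (T : filling) : positive_entries T ->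
  {in tagged_entries T, forall c, 0 < f c} ->
  {in tagged_entries T &, {mono f : c d / (c < d)%O >-> c < d}} ->
  forall i j k l, k <= l ->
  (nth 0 (nth [::] (map_tagged f T) i) k < nth 0 (nth [::] (map_tagged f T) j) l) =
  (nth 0 (nth [::] T i) k < nth 0 (nth [::] T j) l).
Proof.
move=> T_pos f_pos f_mono i j k l kl; rewrite !nth_map_tagged.
have [lj|/(nth_default 0) ->] := ltnP l (size (nth [::] T j)); last by rewrite !ltn0.
have [ki|ki] := ltnP k (size (nth [::] T i)).
  by rewrite f_mono ?mem_tagged_entries // tagged_ltE /=; lia.
rewrite f_pos ?mem_tagged_entries // nth_default //; apply/esym.
rewrite /positive_entries -all_flatten -unzip1_tagged_entries all_map in T_pos.
exact: (allP T_pos _ (mem_tagged_entries lj)).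
Qed.

Lemma sorted_geq_rowsP (T : filling) :
  all (sorted geq) T <-> forall i k, entry T i k.+1 <= entry T i k.
Proof.
split=> [T_dec i [|k] //|T_dec].
  have [iT|Ti] := ltnP i.-1 (size T); last first.
    by rewrite /entry (nth_default _ Ti) !nth_nil.
  exact: leq_nth_sorted_geq (allP T_dec _ (mem_nth _ iT)) (leqnSn k).
apply/(all_nthP [::]) => i iT; apply/(sortedP 0) => k _; exact: (T_dec i.+1 k.+1).
Qed.

(* Every condition in the definition of a ComT compares an entry with an entry
   weakly to its right. *)
Lemma ComT_ltn_entry (a : seq nat) (T U : filling) :
  shape U = shape T -> positive_entries U ->
  (forall i j k l, k <= l ->
     (entry U i k < entry U j l) = (entry T i k < entry T j l)) ->
  ComT a T -> ComT a U.
Proof.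
move=> UT U_pos ltn_UT [Ta _ /sorted_geq_rowsP T_dec T_col T_triple].
split; rewrite ?UT //.
- by apply/sorted_geq_rowsP => i k; rewrite leqNgt ltn_UT // -leqNgt.
- by move=> i j i0 ij ja; rewrite ltn_UT //; apply: T_col.
move=> i j k i0 ij ja km; rewrite leqNgt !ltn_UT ?leq_pred // -leqNgt => Ujk.
apply: T_triple => //; move: Ujk.
have sUT : size U = size T by rewrite -(size_map size) -/(shape U) UT size_map.
have out V : size V = size T -> entry V (size T).+1 0 = 0.
  by move=> VT; rewrite /entry [nth [::] _ _]nth_default //= VT.
by rewrite -!lt0n -{1}(out U) // -[X in _ -> X < _](out T) // ltn_UT.
Qed.

Lemma ComT_map_tagged (a : seq nat) (f : tagged -> nat) (T : filling) :
  positive_entries T -> {in tagged_entries T, forall c, 0 < f c} ->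
  {in tagged_entries T &, {mono f : c d / (c < d)%O >-> c < d}} ->
  ComT a (map_tagged f T) <-> ComT a T.
Proof.
move=> T_pos f_pos f_mono.
have ltn_entry i j k l : k <= l ->
    (entry (map_tagged f T) i k < entry (map_tagged f T) j l) =
    (entry T i k < entry T j l).
  by move=> kl; apply: ltn_nth_map_tagged => //; rewrite -!subn1 leq_sub2r.
have fT_pos : positive_entries (map_tagged f T).
  by rewrite /positive_entries -all_flatten flatten_map_tagged all_map; apply/allP.
split; apply: ComT_ltn_entry; rewrite ?shape_map_tagged // => i j k l kl.
by rewrite ltn_entry.
Qed.

Lemma tag_columns_disjoint (r s : seq nat) :
  sorted geq r -> triple_rule r s -> head 0 r < head 0 s ->
  ~~ has (mem (tag_columns r)) (tag_columns s).
Proof.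
move=> r_dec rs rs0; apply/hasPn => _ /tag_columnsP[k ks ->].
apply/negP => /tag_columnsP[l lr [+ elk]]; rewrite -{l}elk in lr *.
case: k ks lr => [|k] ks _ /eqP; first by rewrite !nth0 gtn_eqF.
by rewrite eq_sym (negPf (triple_rule_column_neq r_dec rs ks)).
Qed.

Lemma ComT_uniq_tagged_entries (a : seq nat) (T : filling) :
  ComT a T -> uniq (tagged_entries T).
Proof.
move=> /ComT_rowsP[_ _]; rewrite (sorted_pairwise ltn_trans) pairwise_map.
elim: T {a} => //= r T IHT /andP[r_dec T_dec] /andP[r_col T_col].
move=> /andP[r_triple T_triple].
rewrite /tagged_entries /= cat_uniq uniq_tag_columns /= [X in _ && X]IHT // andbT.
apply/hasPn => c /flatten_mapP[s sT]; apply: contraL => cr; apply/negP => cs.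
have /negP := tag_columns_disjoint r_dec (allP r_triple s sT) (allP r_col s sT).
by apply; apply/hasP; exists c.
Qed.

Definition standard (S : filling) : bool :=
  perm_eq (flatten S) (iota 1 (size (flatten S))).

Lemma standard_uniq (S : filling) : standard S -> uniq (flatten S).
Proof. by move=> /perm_uniq ->; apply: iota_uniq. Qed.

Lemma standard_ComTE (a : seq nat) : standard_ComT a = ComT a `&` [set T | standard T].
Proof.
apply/seteqP; split=> T [aT]; have [Ta _ _ _ _] := aT.
  by move=> Tstd; split=> //=; rewrite /standard size_flatten Ta.
by rewrite /= /standard size_flatten Ta.
Qed.

Definition column_word (S : filling) : seq nat :=
  [seq column S v | v <- iota 1 (size (flatten S))].

(* [w] lists the values that replace the numbers [1], [2], ... of the standard
   filling [S]. *)
Definition compatible (w : seq nat) (S : filling) : Prop :=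
  size w = size (flatten S) /\
  {in descents S, forall p, nth 0 w p.-1 < nth 0 w p}.

Definition standardize (T : filling) : filling :=
  map_tagged (fun c => (index c (sort <=%O (tagged_entries T))).+1) T.

Definition destandardize (w : seq nat) (S : filling) : filling :=
  map_tagged (fun c => nth 0 w c.1.-1) S.

Lemma mem_descents (S : filling) (p : nat) :
  (p \in descents S) =
  [&& 0 < p, p < size (flatten S) & column S p <= column S p.+1].
Proof. by rewrite mem_filter mem_iota -leqNgt; lia. Qed.

Lemma compatibleP (w : seq nat) (S : filling) :
  sorted leq w -> size w = size (flatten S) ->
  compatible w S <-> sorted <%O (zip w (column_word S) : seq tagged).
Proof.
move=> w_inc wS; have sw : size w = size (column_word S) by rewrite size_map size_iota.
have colE p : p < size w -> nth 0 (column_word S) p = column S p.+1.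
  by move=> pw; rewrite (nth_map 0) ?nth_iota ?size_iota -?wS.
have ltE p : p.+1 < size w ->
    (nth (0, 0) (zip w (column_word S)) p <
     nth (0, 0) (zip w (column_word S)) p.+1 :> tagged)%O =
    (column S p.+1 <= column S p.+2) ==> (nth 0 w p < nth 0 w p.+1).
  move=> pw; rewrite tagged_ltE !nth_zip //= !colE ?(ltnW pw) //.
  by have := sortedP 0 w_inc p pw; lia.
split=> [[_ w_asc]|zip_inc].
  apply/(sortedP (0, 0)) => p; rewrite size_zip -sw minnn => pw; rewrite ltE //.
  by apply/implyP => desc; apply: (w_asc p.+1); rewrite mem_descents -wS pw.
split=> // -[|p]; rewrite mem_descents // => /and3P[_]; rewrite -wS => pw.
apply/implyP; rewrite -ltE //; apply: (sortedP _ zip_inc).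
by rewrite size_zip -sw minnn.
Qed.

Lemma ComT_standardize (a : seq nat) (T : filling) :
  positive_entries T -> uniq (tagged_entries T) -> ComT a (standardize T) <-> ComT a T.
Proof.
move=> T_pos T_uniq; apply: ComT_map_tagged => // c d cT dT; rewrite ltnS.
by rewrite index_lt_sorted ?mem_sort // sort_lt_sorted.
Qed.

Lemma size_flatten_map_tagged (f : tagged -> nat) (T : filling) :
  size (flatten (map_tagged f T)) = size (flatten T).
Proof. by rewrite !size_flatten shape_map_tagged. Qed.

Lemma standardize_standard (T : filling) :
  uniq (tagged_entries T) -> standard (standardize T).
Proof.
move=> T_uniq; rewrite /standard size_flatten_map_tagged flatten_map_tagged.
rewrite (iotaDl 1 0) -unzip1_tagged_entries size_map.
rewrite -(size_sort <=%O (tagged_entries T)) -map_index_uniq ?sort_uniq // -map_comp.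
by apply: perm_map; rewrite perm_sym perm_sort.
Qed.

Lemma unzip1_sort_tagged_entries (w : seq nat) (T : filling) : sorted leq w ->
  perm_eq (flatten T) w -> unzip1 (sort <=%O (tagged_entries T)) = w.
Proof.
move=> w_inc Tw; apply: (sorted_eq leq_trans anti_leq) => //.
  apply: (homo_sorted (e := <=%O : rel tagged)); last exact: sort_le_sorted.
  by move=> c d; rewrite leEprodlexi leEnat => /andP[].
apply: perm_trans Tw; rewrite -unzip1_tagged_entries.
by apply: perm_map; rewrite perm_sort.
Qed.

Lemma unzip2_sort_tagged_entries (T : filling) : uniq (tagged_entries T) ->
  unzip2 (sort <=%O (tagged_entries T)) = column_word (standardize T).
Proof.
move=> T_uniq; have S_uniq := standard_uniq (standardize_standard T_uniq).
rewrite /column_word size_flatten_map_tagged -unzip1_tagged_entries size_map.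
rewrite (iotaDl 1 0) -(size_sort <=%O (tagged_entries T)).
rewrite -map_index_uniq ?sort_uniq // -!map_comp.
apply/eq_in_map => c; rewrite mem_sort => cT /=; apply/esym/column_tagged_entries => //.
by rewrite tagged_entries_map; apply/mapP; exists c.
Qed.

Lemma standardize_compatible (w : seq nat) (T : filling) : uniq (tagged_entries T) ->
  sorted leq w -> perm_eq (flatten T) w -> compatible w (standardize T).
Proof.
move=> T_uniq w_inc Tw; apply/compatibleP => //.
  by rewrite size_flatten_map_tagged (perm_size Tw).
rewrite -(unzip1_sort_tagged_entries w_inc Tw) -unzip2_sort_tagged_entries //.
by rewrite zip_unzip sort_lt_sorted.
Qed.

Lemma standardizeK (w : seq nat) (T : filling) : sorted leq w ->
  perm_eq (flatten T) w -> destandardize w (standardize T) = T.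
Proof.
move=> w_inc Tw; rewrite /destandardize map_tagged_comp.
apply: map_tagged_id_in => c cT /=; rewrite -(unzip1_sort_tagged_entries w_inc Tw).
by rewrite (nth_map c) ?index_mem ?nth_index ?mem_sort.
Qed.

Lemma tagged_entries_destandardize (w : seq nat) (S : filling) :
  standard S -> size w = size (flatten S) ->
  perm_eq (tagged_entries (destandardize w S)) (zip w (column_word S)).
Proof.
move=> S_std wS; rewrite tagged_entries_map tagged_entries_column ?standard_uniq //.
rewrite -map_comp -{2}[w](map_nth_iota1 0) wS zip_map.
exact: perm_map S_std.
Qed.

Lemma flatten_destandardize (w : seq nat) (S : filling) :
  standard S -> size w = size (flatten S) -> perm_eq (flatten (destandardize w S)) w.
Proof.
move=> S_std wS; rewrite -unzip1_tagged_entries.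
have /(perm_map fst) := tagged_entries_destandardize S_std wS.
by rewrite -/unzip1 unzip1_zip // size_map size_iota wS.
Qed.

Lemma sort_tagged_entries_destandardize (w : seq nat) (S : filling) :
  sorted leq w -> standard S -> compatible w S ->
  sort <=%O (tagged_entries (destandardize w S)) = zip w (column_word S).
Proof.
move=> w_inc S_std Sw; have wS := Sw.1; move/compatibleP: Sw => /(_ w_inc wS) zip_inc.
apply: le_sorted_eq; first exact: sort_le_sorted.
  by rewrite lt_sorted_uniq_le in zip_inc; case/andP: zip_inc.
by rewrite perm_sort tagged_entries_destandardize.
Qed.

Lemma destandardize_uniq (w : seq nat) (S : filling) :
  sorted leq w -> standard S -> compatible w S ->
  uniq (tagged_entries (destandardize w S)).
Proof.
move=> w_inc S_std Sw; rewrite -sort_lt_sorted sort_tagged_entries_destandardize //.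
by apply/compatibleP => //; case: Sw.
Qed.

Lemma destandardizeK (w : seq nat) (S : filling) :
  sorted leq w -> standard S -> compatible w S ->
  standardize (destandardize w S) = S.
Proof.
move=> w_inc S_std Sw; have S_uniq := standard_uniq S_std; have wS := Sw.1.
have L_uniq := destandardize_uniq w_inc S_std Sw.
rewrite -(sort_uniq <=%O) in L_uniq.
rewrite /standardize sort_tagged_entries_destandardize // in L_uniq *.
rewrite map_tagged_comp; apply: map_tagged_id_in => -[p k] pk /=.
rewrite -(column_tagged_entries S_uniq pk).
have : p \in flatten S by rewrite -unzip1_tagged_entries; apply/mapP; exists (p, k).
rewrite (perm_mem S_std) mem_iota -wS => /andP[p0 pw].
have pw' : p.-1 < size w by lia.
have -> : (nth 0 w p.-1, column S p) = nth (0, 0) (zip w (column_word S)) p.-1.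
  have sw : size w = size (column_word S) by rewrite size_map size_iota.
  by rewrite nth_zip // (nth_map 0) ?size_iota -?wS // nth_iota -?wS // add1n prednK.
by rewrite index_uniq ?size_zip ?size_map ?size_iota -?wS ?minnn ?prednK.
Qed.

Lemma ComT_destandardize (a w : seq nat) (S : filling) :
  sorted leq w -> all (leq 1) w -> standard S -> compatible w S -> ComT a S ->
  ComT a (destandardize w S).
Proof.
move=> w_inc w_pos S_std Sw aS.
apply/ComT_standardize; rewrite ?destandardize_uniq ?destandardizeK //.
rewrite /positive_entries -all_flatten.
by rewrite (perm_all _ (flatten_destandardize S_std Sw.1)).
Qed.

Lemma destandardize_bij (a w : seq nat) : sorted leq w -> all (leq 1) w ->
  set_bij (standard_ComT a `&` [set S | compatible w S])
          (ComT a `&` [set T | perm_eq (flatten T) w]) (destandardize w).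
Proof.
move=> w_inc w_pos; rewrite standard_ComTE.
apply: (set_bij_can (g := standardize)) => [S|T|S|T].
- move=> [[aS S_std] Sw]; split; first exact: ComT_destandardize.
  exact: flatten_destandardize S_std Sw.1.
- move=> [aT Tw]; have T_uniq := ComT_uniq_tagged_entries aT.
  split; last exact: standardize_compatible.
  split; last exact: standardize_standard.
  by apply/ComT_standardize => //; case: aT.
- by move=> /set_mem[[aS S_std] Sw]; apply: destandardizeK.
- by move=> /set_mem[aT Tw]; apply: standardizeK.
Qed.

(** * Coefficients of the fundamental quasisymmetric functions *)

Local Notation psums := (scanl addn 0).

Lemma foldl_addn (x : nat) (s : seq nat) : foldl addn x s = x + sumn s.
Proof. by elim: s x => [|y s IHs] x /=; rewrite ?addn0 // IHs addnA. Qed.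

Lemma scanl_addn (x : nat) (s : seq nat) : scanl addn x s = [seq x + y | y <- psums s].
Proof.
elim: s x => //= y s IHs x; rewrite add0n IHs [in RHS](IHs y) -map_comp.
by congr cons; apply: eq_map => z /=; rewrite addnA.
Qed.

Lemma psums_cons (x : nat) (s : seq nat) :
  psums (x :: s) = x :: [seq x + y | y <- psums s].
Proof. by rewrite /= add0n (scanl_addn x). Qed.

Lemma psums_cat (s t : seq nat) :
  psums (s ++ t) = psums s ++ [seq sumn s + y | y <- psums t].
Proof. by rewrite scanl_cat foldl_addn add0n (scanl_addn (sumn s)). Qed.

Lemma last_psums (s : seq nat) : last 0 (psums s) = sumn s.
Proof. by case/lastP: s => // s x; rewrite scanl_rcons last_rcons foldl_addn. Qed.

Lemma sumn_in_psums (s : seq nat) : s != [::] -> sumn s \in psums s.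
Proof. by rewrite -last_psums; case: s => // x s _; rewrite psums_cons /= mem_last. Qed.

Lemma mem_psums_le (s : seq nat) (y : nat) : y \in psums s -> y <= sumn s.
Proof.
elim: s y => // x s IHs y; rewrite psums_cons in_cons => /orP[/eqP->|].
  exact: leq_addr.
by move=> /mapP[z /IHs zs ->]; rewrite leq_add2l.
Qed.

Lemma mem_psums_gt0 (s : seq nat) (y : nat) :
  is_composition s -> y \in psums s -> 0 < y.
Proof.
case: s => // x s /andP[x0 _]; rewrite psums_cons in_cons => /orP[/eqP->//|].
by move=> /mapP[z _ ->]; rewrite addn_gt0 x0.
Qed.

Lemma mem_psumsP (s : seq nat) (y : nat) :
  reflect (exists2 k, k < size s & sumn (take k.+1 s) = y) (y \in psums s).
Proof.
apply: (iffP (nthP 0)) => -[k]; rewrite ?size_scanl => ks.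
  by rewrite nth_scanl // foldl_addn => <-; exists k.
by move=> <-; exists k; rewrite ?size_scanl ?nth_scanl ?foldl_addn.
Qed.

Lemma coarsening_cons (s a b : seq nat) :
  s != [::] -> coarsening a b -> coarsening (sumn s :: a) (s ++ b).
Proof.
move=> s0 [bs [bs0 <- <-]]; exists (s :: bs); split=> //.
by rewrite in_cons negb_or eq_sym s0.
Qed.

Lemma coarseningP (a b : seq nat) : is_composition a -> is_composition b ->
  coarsening a b <-> sumn b = sumn a /\ {subset psums a <= psums b}.
Proof.
move=> a_comp b_comp; split=> [[bs [bs0 <- <-]]|[]].
  split; first by rewrite sumn_flatten.
  elim: bs bs0 => // s bs IHbs; rewrite in_cons negb_or eq_sym.
  move=> /andP[s0 /IHbs bs_sub] y.
  rewrite [flatten _]/= [map _ _]/= psums_cons psums_cat in_cons mem_cat.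
  case/orP=> [/eqP->|/mapP[z /bs_sub zb ->]]; first by rewrite sumn_in_psums.
  by rewrite map_f ?orbT.
elim: a b a_comp b_comp => [|x a IHa] b.
  move=> _ b_comp b0 _; exists [::]; split=> //.
  by case: b b_comp b0 => //= -[].
move=> /andP[_ a_comp] b_comp ab sub_ab.
have /sub_ab/mem_psumsP[k kb xE] : x \in psums (x :: a) by rewrite psums_cons mem_head.
move: b_comp ab sub_ab; rewrite -(cat_take_drop k.+1 b) /is_composition all_cat.
rewrite sumn_cat psums_cat xE psums_cons => /andP[_ b_comp] /addnI ab sub_ab.
rewrite -xE; apply: coarsening_cons; first by case: (b) kb.
apply: IHa => // y ya; have := sub_ab (x + y).
rewrite in_cons map_f // orbT mem_cat => /(_ isT) /orP[/mem_psums_le|].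
  by have := mem_psums_gt0 a_comp ya; rewrite xE; lia.
by rewrite mem_map //; apply: addnI.
Qed.

Lemma psums_pairmap (x : nat) (s : seq nat) : path leq x s ->
  scanl addn x (pairmap (fun y z => z - y) x s) = s.
Proof. by elim: s x => //= y s IHs x /andP[xy ys]; rewrite subnKC ?IHs. Qed.

Lemma pairmap_composition (x : nat) (s : seq nat) : path ltn x s ->
  is_composition (pairmap (fun y z => z - y) x s).
Proof. by elim: s x => //= y s IHs x /andP[xy /IHs ->]; rewrite subn_gt0 xy. Qed.

Lemma beta_composition (N : nat) (s : seq nat) :
  (0 < N -> path ltn 0 (rcons s N)) -> is_composition (beta N s).
Proof. by rewrite /beta; case: posnP => // _ /(_ isT); apply: pairmap_composition. Qed.

Lemma psums_beta (N : nat) (s : seq nat) :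
  0 < N -> path ltn 0 (rcons s N) -> psums (beta N s) = rcons s N.
Proof.
move=> N0 s_inc; rewrite /beta gtn_eqF // psums_pairmap //.
by apply: sub_path s_inc => x y; apply: ltnW.
Qed.

Lemma sumn_beta (N : nat) (s : seq nat) :
  (0 < N -> path ltn 0 (rcons s N)) -> sumn (beta N s) = N.
Proof.
case: (posnP N) => [->//|N0 /(_ isT) s_inc].
by rewrite -last_psums psums_beta // last_rcons.
Qed.

Lemma path_descents (S : filling) : 0 < size (flatten S) ->
  path ltn 0 (rcons (descents S) (size (flatten S))).
Proof.
move=> S0; rewrite rcons_path; apply/andP; split.
  rewrite (path_pairwise ltn_trans) /= -(sorted_pairwise ltn_trans).
  rewrite sorted_filter ?iota_ltn_sorted ?andbT //; last exact: ltn_trans.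
  by apply/allP => p; rewrite mem_descents => /and3P[].
have := mem_last 0 (descents S); rewrite in_cons => /orP[/eqP->//|].
by rewrite mem_descents => /and3P[].
Qed.

Lemma sorted_tally_seq (bs : seq (nat * nat)) :
  sorted ltn (unzip1 bs) -> sorted leq (tally_seq bs).
Proof.
rewrite (sorted_pairwise ltn_trans) (sorted_pairwise leq_trans) pairwise_map.
elim: bs => //= -[x n] bs IHbs /andP[x_bs /IHbs bs_inc].
rewrite /tally_seq /= pairwise_cat -/(tally_seq bs) bs_inc andbT; apply/andP; split.
  apply/allrelP => y z; rewrite mem_nseq => /andP[_ /eqP->].
  move=> /flatten_mapP[c cbs]; rewrite mem_nseq => /andP[_ /eqP->].
  exact/ltnW/(allP x_bs c cbs).
by elim: n {x_bs} => //= n ->; rewrite all_nseq leqnn orbT.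
Qed.

Lemma nth_tally_seq_cons (x n : nat) (bs : seq (nat * nat)) (p : nat) :
  nth 0 (tally_seq ((x, n) :: bs)) p =
  if p < n then x else nth 0 (tally_seq bs) (p - n).
Proof. by rewrite /tally_seq /= nth_cat size_nseq nth_nseq; case: ltnP. Qed.

Lemma mem_psums_tally_seq (bs : seq (nat * nat)) (p : nat) :
  sorted ltn (unzip1 bs) -> is_composition (unzip2 bs) -> 0 < p < sumn (unzip2 bs) ->
  (p \in psums (unzip2 bs)) = (nth 0 (tally_seq bs) p.-1 < nth 0 (tally_seq bs) p).
Proof.
rewrite (sorted_pairwise ltn_trans) pairwise_map.
elim: bs p => [|[x n] bs IHbs] p; first by rewrite ltn0 andbF.
move=> /andP[x_bs bs_inc] /andP[n0 bs_comp] /andP[p0 p_sum].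
rewrite [unzip2 _]/= psums_cons in_cons !nth_tally_seq_cons.
have [pn|np|epn] := ltngtP p n.
- rewrite (leq_ltn_trans (leq_pred p) pn) ltnn.
  by apply/negbTE/mapP => -[y _ yE]; rewrite yE ltnNge leq_addr in pn.
- rewrite ifF; last lia; have -> : p.-1 - n = (p - n).-1 by lia.
  rewrite /= in p_sum; rewrite -IHbs //; last lia.
  by rewrite -{1}(subnKC (ltnW np)) mem_map //; apply: addnI.
- rewrite epn prednK // leqnn subnn; apply/esym.
  have : 0 < size (tally_seq bs).
    by rewrite size_tally_seq; move: p_sum; rewrite epn -[X in X < _]addn0 ltn_add2l.
  move=> /(mem_nth 0) /flatten_mapP[c cbs]; rewrite mem_nseq => /andP[_ /eqP->].
  exact: allP x_bs c cbs.
Qed.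

Lemma zip_wf_tally (i c : seq nat) :
  uniq i -> is_composition c -> size i = size c -> zip i c \is a wf_tally nat.
Proof.
move=> i_uniq c_comp ic; rewrite qualifE /= unzip1_zip ?unzip2_zip ?ic // i_uniq /=.
by apply/negP => /(allP c_comp).
Qed.

Definition vars (m : monomial) : seq nat := sort leq (undup m).

Definition exponents (m : monomial) : seq nat := [seq m x | x <- vars m].

Lemma mem_vars (m : monomial) (x : nat) : (x \in vars m) = (x \in m).
Proof. by rewrite mem_sort mem_undup. Qed.

Lemma sorted_vars (m : monomial) : sorted ltn (vars m).
Proof.
by rewrite ltn_sorted_uniq_leq sort_uniq undup_uniq sort_sorted //; apply: leq_total.
Qed.

Lemma exponents_composition (m : monomial) : is_composition (exponents m).
Proof. by apply/allP => _ /mapP[x xm ->]; rewrite -in_mset -mem_vars. Qed.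

Lemma zip_vars_exponents (m : monomial) :
  zip (vars m) (exponents m) = [seq (x, m x) | x <- vars m].
Proof. by rewrite -{1}[vars m]map_id zip_map. Qed.

Lemma vars_exponents_wf_tally (m : monomial) :
  zip (vars m) (exponents m) \is a wf_tally nat.
Proof.
by apply: zip_wf_tally; rewrite ?exponents_composition ?size_map ?sort_uniq ?undup_uniq.
Qed.

Lemma sort_tally_seq (m : monomial) :
  sort leq m = tally_seq (zip (vars m) (exponents m)).
Proof.
apply: (sorted_eq leq_trans anti_leq); first exact/sort_sorted/leq_total.
  by rewrite sorted_tally_seq // unzip1_zip ?size_map ?sorted_vars.
rewrite perm_sort perm_sym -(permPr (perm_count_undup m)) zip_vars_exponents.
rewrite /tally_seq -map_comp; under eq_map do rewrite /= -count_mem_mset.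
by apply/perm_flatten/perm_map; rewrite perm_sort.
Qed.

Lemma sumn_exponents (m : monomial) : sumn (exponents m) = size m.
Proof.
by rewrite -(size_sort leq) sort_tally_seq size_tally_seq unzip2_zip ?size_map.
Qed.

Lemma seq_mset_sort (m : monomial) : seq_mset (sort leq m) = m.
Proof. by rewrite -[RHS]seq_mset_id; apply/eq_seq_msetP; rewrite perm_sort. Qed.

Lemma M_termE (c i : seq nat) : M_term c i = seq_mset (tally_seq (zip i c)).
Proof.
apply/msetP => x; rewrite mset_seqE /M_term /tally_seq.
elim: (zip i c) => [|[y n] s IHs]; first by rewrite big_nil mset0E.
rewrite big_cons msetE2 IHs msetnE /= count_cat count_nseq /= eq_sym.
by case: eqP; rewrite ?mul1n.
Qed.

Lemma M_term_exponents (m : monomial) : M_term (exponents m) (vars m) = m.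
Proof. by rewrite M_termE -sort_tally_seq seq_mset_sort. Qed.

Lemma vars_exponents_M_term (c i : seq nat) : is_composition c -> size i = size c ->
  sorted ltn i -> vars (M_term c i) = i /\ exponents (M_term c i) = c.
Proof.
move=> c_comp ic i_inc; set m := M_term c i.
have tally_eq : tally_seq (zip (vars m) (exponents m)) = tally_seq (zip i c).
  rewrite -sort_tally_seq; apply: (sorted_eq leq_trans anti_leq).
  - exact/sort_sorted/leq_total.
  - by rewrite sorted_tally_seq // unzip1_zip ?ic.
  - by rewrite perm_sort /m M_termE perm_eq_seq_mset.
have zip_eq : zip (vars m) (exponents m) = zip i c.
  apply: (can_in_inj (@tally_seqK _)) tally_eq; first exact: vars_exponents_wf_tally.
  exact: zip_wf_tally (sorted_uniq ltn_trans ltnn i_inc) c_comp ic.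
split; first rewrite -[LHS](@unzip1_zip _ _ _ (exponents m)) ?size_map //.
  by rewrite zip_eq unzip1_zip ?ic.
by rewrite -[LHS](@unzip2_zip _ _ (vars m)) ?size_map // zip_eq unzip2_zip ?ic.
Qed.

Lemma qsym_M_coef (c : seq nat) (m : monomial) : is_composition c ->
  qsym_M c m = ((0%N \notin m) && (c == exponents m))%:R%R.
Proof.
move=> c_comp; have [/andP[m0 /eqP cE]|not_cm] := boolP (_ && _); last first.
  apply: fsbig1 => i [ic i_pos i_inc]; rewrite /mono; case: eqP => // mE.
  have [iE cE] := vars_exponents_M_term c_comp ic i_inc; case/negP: not_cm.
  by rewrite mE cE eqxx andbT -mem_vars iE; apply/negP => /(allP i_pos).
rewrite /qsym_M /psum -(@fsbig_widen _ _ _ _ [set vars m]).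
- by rewrite fsbig_set1 cE /mono M_term_exponents eqxx.
- move=> _ ->; split; rewrite ?sorted_vars ?cE ?size_map //.
  by apply/allP => x; rewrite mem_vars; case: x m0 => // /negPf ->.
- move=> i [[ic _ i_inc] /= i_neq]; rewrite /mono; case: eqP => // mE; case: i_neq.
  by rewrite mE; case: (vars_exponents_M_term c_comp ic i_inc).
Qed.

Lemma qsym_F_coef (b : seq nat) (m : monomial) :
  qsym_F b m = ((0%N \notin m) && `[< coarsening b (exponents m) >])%:R%R.
Proof.
have m_comp := exponents_composition m; rewrite /qsym_F /psum.
have [/andP[m0 /asboolP bm]|not_bm] := boolP (_ && _); last first.
  apply: fsbig1 => c [c_comp bc]; rewrite qsym_M_coef //; case: eqP => [cE|_].
    by move: not_bm; rewrite -cE (asboolT bc) !andbT => /negPf ->.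
  by rewrite andbF.
rewrite -(@fsbig_widen _ _ _ _ [set exponents m]).
- by rewrite fsbig_set1 qsym_M_coef // m0 eqxx.
- by move=> _ ->.
- by move=> c [[c_comp _] /= /eqP/negPf c_neq]; rewrite /= qsym_M_coef // c_neq andbF.
Qed.

Lemma descent_composition_composition (S : filling) :
  is_composition (descent_composition S).
Proof. exact/beta_composition/path_descents. Qed.

Lemma sumn_descent_composition (S : filling) :
  sumn (descent_composition S) = size (flatten S).
Proof. exact/sumn_beta/path_descents. Qed.

Lemma mem_psums_exponents (m : monomial) (p : nat) : 0 < p < size m ->
  (p \in psums (exponents m)) = (nth 0 (sort leq m) p.-1 < nth 0 (sort leq m) p).
Proof.
move=> pm; have zip2 : unzip2 (zip (vars m) (exponents m)) = exponents m.
  by rewrite unzip2_zip ?size_map.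
rewrite sort_tally_seq -mem_psums_tally_seq ?zip2 ?sumn_exponents //.
  by rewrite unzip1_zip ?size_map ?sorted_vars.
exact: exponents_composition.
Qed.

Lemma coarsening_descent_composition (S : filling) (m : monomial) :
  coarsening (descent_composition S) (exponents m) <-> compatible (sort leq m) S.
Proof.
rewrite coarseningP ?descent_composition_composition ?exponents_composition //.
rewrite sumn_exponents sumn_descent_composition.
rewrite /compatible size_sort; have [S0|S0] := posnP (size (flatten S)).
  rewrite /descent_composition S0; split=> -[mS _]; split=> // p.
  by rewrite mem_descents S0 andbF.
have ascentE p : size m = size (flatten S) -> p \in descents S ->
    (p \in psums (exponents m)) = (nth 0 (sort leq m) p.-1 < nth 0 (sort leq m) p).
  by rewrite mem_descents => Sm /and3P[p0 pS _]; rewrite mem_psums_exponents // p0 Sm.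
rewrite /descent_composition psums_beta ?path_descents //.
split=> -[Sm asc]; split=> // p; rewrite ?mem_rcons ?in_cons.
  by move=> pS; rewrite -ascentE //; apply: asc; rewrite mem_rcons in_cons pS orbT.
case/orP=> [/eqP->|pS]; last by rewrite ascentE ?asc.
rewrite -Sm -sumn_exponents sumn_in_psums //.
by apply: contraTneq S0 => m0; rewrite -Sm -sumn_exponents m0.
Qed.

(** * The expansion *)

Lemma quasi_schur_SSAF (a : seq nat) :
  quasi_schur a = psum (SSAF_expanding a) (fun T => mono (content T)).
Proof.
apply/funext => m; rewrite /quasi_schur /psum.
rewrite [RHS](@partition_fsbig _ _ _ _ _ _ (expansion a) shape).
- apply: eq_fsbigr => g; rewrite inE => ag.
  apply: eq_fsbigl; apply/seteqP; split=> T /=.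
    by move=> gT; split; [exists g | case: gT => -[]].
  by move=> [/SSAF_expandingP[_ T_SSAF] <-].
- apply: (sub_finite_set _ (finite_fillings m (finite_expansions a m))).
  move=> T [/SSAF_expandingP[aT T_SSAF] /mono_neq0/content_perm Tm].
  by split=> //; split=> //; exists T.
- by move=> T /SSAF_expandingP[].
Qed.

Lemma quasi_schur_ComT (a : seq nat) : is_composition a ->
  quasi_schur a = psum (ComT a) (fun T => mono (content T)).
Proof.
move=> a_comp; rewrite quasi_schur_SSAF; apply/funext => m.
rewrite /psum [RHS](reindex_fsbig _ _ _ _ (drop_empty_bij a_comp)).
by apply: eq_fsbigr => T _; rewrite /content flatten_drop_empty.
Qed.

Lemma mono_content (T : filling) (m : monomial) :
  mono (content T) m = `[< perm_eq (flatten T) (sort leq m) >]%:R%R.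
Proof.
rewrite /mono -{1}(seq_mset_sort m) eq_sym; congr (_ : bool)%:R%R.
by apply/eqP/asboolP => /eq_seq_msetP.
Qed.

Lemma psum_ComT_standard (a : seq nat) :
  psum (ComT a) (fun T => mono (content T)) =
  psum (standard_ComT a) (fun S => qsym_F (descent_composition S)).
Proof.
apply/funext => m; rewrite /psum; have [m0|m0] := boolP (0 \in m).
  rewrite !fsbig1 // => [S _|T [_ T_pos _ _ _]]; first by rewrite qsym_F_coef m0.
  rewrite /positive_entries -all_flatten in T_pos; rewrite /mono; case: eqP => // mT.
  by move: m0; rewrite -(perm_mem (content_perm mT)) => /(allP T_pos).
have w_pos : all (leq 1) (sort leq m).
  by apply/allP => x; rewrite mem_sort; case: x m0 => // /negPf ->.
have w_inc : sorted leq (sort leq m) by exact/sort_sorted/leq_total.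
under eq_fsbigr do rewrite mono_content.
rewrite fsum_indicator (reindex_fsbig _ _ _ _ (destandardize_bij a w_inc w_pos)).
rewrite -fsum_indicator; apply: eq_fsbigr => S _; rewrite qsym_F_coef m0 /=.
congr (_ : bool)%:R%R; apply: asbool_equiv_eq; symmetry.
exact: coarsening_descent_composition.
Qed.

Lemma psum_standard_ComT_descents (a : seq nat) :
  psum (standard_ComT a) (fun S => qsym_F (descent_composition S)) =
  psum composition_set (fun b => qsym_F b *+ d_ComT a b)%R.
Proof.
have fin_std : finite_set (standard_ComT a).
  apply: (sub_finite_set _ (finite_fillings (iota 1 (sumn a)) (finite_set1 a))).
  by move=> S [[Sa _ _ _ _] ?].
apply/funext => m; rewrite /psum.
rewrite (@partition_fsbig _ _ _ _ _ _ composition_set descent_composition).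
- apply: eq_fsbigr => b _; rewrite natmulfctE /d_ComT -fsum_const.
    by apply: eq_fsbigr => S; rewrite inE => -[_ <-].
  exact: finite_d_ComT_set.
- exact: finite_setIl.
- by move=> S _; apply: descent_composition_composition.
Qed.

Lemma d_SAF_ComT (a b : seq nat) : is_composition a -> d_SAF a b = d_ComT a b.
Proof.
move=> a_comp; pose P := [set T | perm_eq (flatten T) (iota 1 (sumn a)) /\
                                  descent_composition T = b].
have d_SAF_setE : d_SAF_set a b = SSAF_expanding a `&` drop_empty @^-1` P.
  apply/seteqP; split=> T;
    rewrite /P /= flatten_drop_empty descent_composition_drop_empty.
    move=> [[g [g_last <-] [gT Tg]] Tb]; split; first by exists g.
    by split=> //; rewrite sumn_compress; apply/eq_seq_msetP.
  move=> [[g ag gT] [Ta Tb]]; split=> //; exists g => //; split=> //.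
  by case: ag => _ ga; apply/eq_seq_msetP; rewrite -sumn_compress ga.
have d_ComT_setE : d_ComT_set a b = ComT a `&` P.
  by apply/seteqP; split=> T /=; [case=> [[]] | case=> ? []].
rewrite /d_SAF /d_ComT d_ComT_setE; apply: (@card_fset_set_bij _ _ _ _ drop_empty).
  exact: finite_d_SAF_set.
by rewrite d_SAF_setE; apply/set_bij_setI_preimage/drop_empty_bij.
Qed.

Local Open Scope ring_scope.

Theorem theorem6p2 (a : seq nat) (ha : is_composition a) :
  quasi_schur a = psum composition_set (fun b => qsym_F b *+ d_SAF a b) /\
  (forall b : seq nat, is_composition b -> d_SAF a b = d_ComT a b).
Proof.
split=> [|b _]; last exact: d_SAF_ComT.
rewrite quasi_schur_ComT // psum_ComT_standard psum_standard_ComT_descents.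
by congr psum; apply/funext => b; rewrite d_SAF_ComT.
Qed.
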